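(* Let $\mathbb{X}$ be a reflexive real Banach space such that $\mathbb{X}^*$ satisfies the Kadets-Klee Property. Let $\mathbb{Y}$ be a proper closed linear subspace of $\mathbb{X}$ with $\dim \mathbb{Y} > 1$. If $\mathbb{Y}$ is a strongly anti-coproximinal subspace of $\mathbb{X}$, then for each nonzero $x \in \mathbb{X}$ there exists a nonzero $y \in \mathbb{Y}$ such that $J(y) \cap J(x) \neq \emptyset$.
   Context: For nonzero $x \in \mathbb{X}$, $J(x) = \{f \in S_{\mathbb{X}^*} : f(x) = \|x\|\}$, where $S_{\mathbb{X}^*}$ is the unit sphere of the dual. A Banach space $\mathbb{Z}$ satisfies the Kadets-Klee Property if whenever $\{z_n\}$ is a sequence in $\mathbb{Z}$ and $z \in \mathbb{Z}$ with $z_n \to z$ weakly and $\|z_n\| \to \|z\|$, it follows that $z_n \to z$ in norm. For $\epsilon \in [0,1)$ and $x, y \in \mathbb{X}$, $x \perp_B^{\epsilon} y$ means $\|x + \lambda y\|^2 \ge \|x\|^2 - 2\epsilon \|x\| \|\lambda y\|$ for all $\lambda \in \mathbb{R}$ (it is known that this is equivalent to $\|x+\lambda y\| \ge \|x\| - \epsilon\|\lambda y\|$ for all $\lambda \in \mathbb{R}$). An element $y_0 \in \mathbb{Y}$ is an $\epsilon$-best coapproximation to $x$ out of $\mathbb{Y}$ if $y \perp_B^{\epsilon} (x - y_0)$ for all $y \in \mathbb{Y}$. $\mathbb{Y}$ is a strongly anti-coproximinal subspace of $\mathbb{X}$ if for every $x \in \mathbb{X} \setminus \mathbb{Y}$ and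 every $\epsilon \in [0,1)$ there does not exist any $\epsilon$-best coapproximation to $x$ out of $\mathbb{Y}$. *)

(* Defs.v *)
From HB Require Import structures.
From mathcomp Require Import all_boot all_order all_algebra.
From mathcomp Require Import all_classical all_reals all_analysis.

Set Implicit Arguments.
Unset Strict Implicit.
Unset Printing Implicit Defensive.

Import Order.TTheory GRing.Theory Num.Theory.
Import numFieldNormedType.Exports.

Local Open Scope classical_set_scope.
Local Open Scope ring_scope.

(* The topological dual of a real normed space: continuous linear functionals,
   with the pointwise module structure and the operator norm. *)
Section dual.
Context {R : realType} (X : normedModType R).

Definition continuous_linear : {pred X -> R^o} :=
  mem [set f : X -> R^o | linear f /\ continuous f].

Record dual := Dual {
  dual_fun :> X -> R^o;
  dual_funP : dual_fun \in continuous_linear }.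

HB.instance Definition _ := [isSub for dual_fun].
HB.instance Definition _ := [Choice of dual by <:].

Lemma continuous_linear_submod_closed : submod_closed continuous_linear.
Proof.
split.
  rewrite inE; split; first by move=> a u v; rewrite /= scaler0 addr0.
  by move=> x; exact: cvg_cst.
move=> a f g /set_mem[fl fc] /set_mem[gl gc]; rewrite inE; split.
  move=> b u v; rewrite /= /GRing.add/= /GRing.scale/= fl gl.
  by rewrite /GRing.scale/= !mulrDr !mulrA (mulrC a b) addrACA.
move=> x; apply: cvgD; last exact: gc.
by apply: cvgZr; exact: fc.
Qed.

HB.instance Definition _ := GRing.isSubmodClosed.Build R (X -> R^o)
  continuous_linear continuous_linear_submod_closed.
HB.instance Definition _ := [SubChoice_isSubLmodule of dual by <:].

Lemma dual_linear (f : dual) : linear f.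
Proof. by have /set_mem[] := dual_funP f. Qed.

HB.instance Definition _ (f : dual) :=
  GRing.isLinear.Build R X R^o *:%R (dual_fun f) (@dual_linear f).

Lemma dual_continuous (f : dual) : continuous f.
Proof. by have /set_mem[] := dual_funP f. Qed.

Lemma dualP (f g : dual) : f =1 g -> f = g.
Proof. by move=> fg; apply/val_inj/funext. Qed.

Lemma dualD (f g : dual) x : (f + g) x = f x + g x. Proof. by []. Qed.

Lemma dualZ a (f : dual) x : (a *: f) x = a * f x. Proof. by []. Qed.

Definition opnorm (f : dual) : R := sup [set `|f x| | x in [set x | `|x| <= 1]].

Let opnorm_set0 (f : dual) : [set `|f x| | x in [set x | `|x| <= 1]] `|f 0|.
Proof. by exists 0 => //=; rewrite normr0. Qed.

Let opnorm_has_sup (f : dual) :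
  has_sup [set `|f x| | x in [set x | `|x| <= 1]].
Proof.
split; first by exists `|f 0|; exact: opnorm_set0.
have := @continuous_linear_bounded R X R^o 0 f (@dual_continuous f 0).
move=> /bounded_funP/(_ 1)[M fM]; exists M => _ [x /= x1 <-]; exact: fM.
Qed.

Lemma opnorm_ub (f : dual) x : `|x| <= 1 -> `|f x| <= opnorm f.
Proof. by move=> x1; apply: ub_le_sup; [case: (opnorm_has_sup f)|exists x]. Qed.

Lemma opnorm_lub (f : dual) c :
  (forall x, `|x| <= 1 -> `|f x| <= c) -> opnorm f <= c.
Proof.
move=> fc; apply: sup_le_ub; first by case: (opnorm_has_sup f).
by move=> _ [x /= x1 <-]; exact: fc.
Qed.

Lemma opnorm_ge0 (f : dual) : 0 <= opnorm f.
Proof. by apply: le_trans (opnorm_ub f (x := 0) _); rewrite ?normr0. Qed.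

Lemma le_opnorm (f : dual) x : `|f x| <= opnorm f * `|x|.
Proof.
have [->|x0] := eqVneq x 0; first by rewrite linear0 !normr0 mulr0.
have nx0 : 0 < `|x| by rewrite normr_gt0.
have := @opnorm_ub f (`|x|^-1 *: x).
rewrite linearZ/= !normrZ normfV normr_id mulVf ?gt_eqF// => /(_ (lexx _)).
by rewrite mulrC ler_pdivrMr.
Qed.

Lemma opnormD (f g : dual) : opnorm (f + g) <= opnorm f + opnorm g.
Proof.
apply: opnorm_lub => x x1; rewrite dualD (le_trans (ler_normD _ _))//.
by rewrite lerD// opnorm_ub.
Qed.

Lemma opnormZ a (f : dual) : opnorm (a *: f) = `|a| * opnorm f.
Proof.
have le b g : opnorm (b *: g) <= `|b| * opnorm g.
  by apply: opnorm_lub => x x1; rewrite dualZ normrM ler_wpM2l// opnorm_ub.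
apply/eqP; rewrite eq_le le/=.
have [->|a0] := eqVneq a 0; first by rewrite normr0 mul0r opnorm_ge0.
have := le a^-1 (a *: f); rewrite scalerA mulVf// scale1r normfV.
by rewrite ler_pdivlMl ?normr_gt0.
Qed.

Lemma opnorm_eq0 (f : dual) : opnorm f = 0 -> f = 0.
Proof.
move=> f0; apply: dualP => x; apply/eqP; rewrite -normr_le0.
by have := le_opnorm f x; rewrite f0 mul0r.
Qed.

HB.instance Definition _ :=
  Lmodule_isNormed.Build R dual opnormD opnormZ opnorm_eq0.

Lemma dual_normE (f : dual) :
  `|f| = sup [set `|f x| | x in [set x : X | `|x| <= 1]].
Proof. by []. Qed.

End dual.

Section banach_notions.
Context {R : realType}.

Definition reflexive_space (X : normedModType R) : Prop :=
  forall phi : dual (dual X), exists x : X, forall f : dual X, phi f = f x.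

Definition weak_cvg (Z : normedModType R) (z_ : nat -> Z) (z : Z) : Prop :=
  forall f : dual Z, f (z_ n) @[n --> \oo] --> f z.

Definition kadets_klee (Z : normedModType R) : Prop :=
  forall (z_ : nat -> Z) (z : Z),
    weak_cvg z_ z -> `|z_ n| @[n --> \oo] --> `|z| -> z_ @ \oo --> z.

Variable X : normedModType R.

Definition norming_functionals (x : X) : set (dual X) :=
  [set f : dual X | `|f| = 1 /\ f x = `|x|].

Definition approx_orthogonal (eps : R) (x y : X) : Prop :=
  forall lambda : R,
    `|x| ^+ 2 - 2 * eps * `|x| * `|lambda *: y| <= `|x + lambda *: y| ^+ 2.

Definition best_coapproximation (Y : {pred X}) (eps : R) (x y0 : X) : Prop :=
  y0 \in Y /\ forall y, y \in Y -> approx_orthogonal eps y (x - y0).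

Definition strongly_anti_coproximinal (Y : {pred X}) : Prop :=
  forall x, x \notin Y -> forall eps : R, 0 <= eps < 1 ->
    ~ exists y0, best_coapproximation Y eps x y0.

(* dim Y > n, for a possibly infinite-dimensional linear subspace Y *)
Definition dim_gt (n : nat) (Y : {pred X}) : Prop :=
  exists u : 'I_n.+1 -> X, (forall i, u i \in Y) /\
    forall a : 'I_n.+1 -> R, \sum_i a i *: u i = 0 -> forall i, a i = 0.

End banach_notions.

(* Main.v *)
From HB Require Import structures.
Require Import Defs.
From mathcomp Require Import all_boot all_order all_algebra.
From mathcomp Require Import all_classical all_reals all_analysis.
From mathcomp Require Import lra.
Import Order.TTheory GRing.Theory Num.Theory.
Import numFieldNormedType.Exports.
Local Open Scope classical_set_scope.
Local Open Scope ring_scope.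

(** If [x] lies outside [Y], then [0] is not a [(1 - 1/(n+1))]-best
    coapproximation to [x], which yields [y_n] in the unit sphere of [Y] and
    [f_n] in [J(y_n)] with [f_n(x) -> |x|]. Let [f] be a weak cluster point of
    [f_n]; then [f(x) = |x|] and [|f| = 1]. By reflexivity [f] is the weak limit
    of a sequence of terms [f_(n_j)], and by the Kadets-Klee property the
    convergence is in norm. If [y] is a weak limit of the [y_(n_j)] along an
    ultrafilter, then [y] is in [Y] and [f(y) = lim f_(n_j)(y_(n_j)) = 1], so
    [f] belongs to both [J(y)] and [J(x)]. *)

(** * The Hahn-Banach theorem *)

Section hahn_banach.
Set Implicit Arguments.
Unset Strict Implicit.
Unset Printing Implicit Defensive.
Context {R : realType} {X : lmodType R}.
Implicit Types (p q : X -> R) (u v x : X).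

(* Equality in the second clause and [p 0 = 0] follow. *)
Definition sublinear p :=
  (forall u v, p (u + v) <= p u + p v) /\
  (forall a u, 0 < a -> p (a *: u) <= a * p u).

Lemma sublinear0 p : sublinear p -> p 0 = 0.
Proof.
move=> [pD pZ]; have := pD 0 0; have := pZ 2^-1 0.
rewrite scaler0 addr0; lra.
Qed.

Lemma sublinear_ge p u : sublinear p -> - p (- u) <= p u.
Proof.
by move=> sp; have := sp.1 u (- u); rewrite subrr sublinear0//; lra.
Qed.

Lemma sublinearZ p a u : sublinear p -> 0 <= a -> p (a *: u) = a * p u.
Proof.
move=> sp; rewrite le_eqVlt => /predU1P[<-|a0].
  by rewrite scale0r mul0r sublinear0.
apply/eqP; rewrite eq_le sp.2//= mulrC -ler_pdivlMr// mulrC.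
have := sp.2 a^-1 (a *: u); rewrite scalerA mulVf ?gt_eqF// scale1r.
by apply; rewrite invr_gt0.
Qed.

(** The index [k] may depend on the vectors, so one lemma serves infima of chains, shifts, and the
    distance to a subspace. *)
Lemma sublinear_inf (I : Type) (D : set I) (F : I -> X -> R) :
  D !=set0 -> (forall u, has_lbound [set F i u | i in D]) ->
  (forall i j u v, D i -> D j ->
    exists2 k, D k & F k (u + v) <= F i u + F j v) ->
  (forall a i u, 0 < a -> D i -> exists2 k, D k & F k (a *: u) <= a * F i u) ->
  sublinear (fun u => inf [set F i u | i in D]).
Proof.
move=> [i0 Di0] lbF FD FZ.
have ne u : [set F i u | i in D] !=set0 by exists (F i0 u), i0.
split=> [u v|a u a0].
  rewrite -lerBlDr; apply: lb_le_inf => // _ [i Di <-].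
  rewrite lerBlDl -lerBlDr; apply: lb_le_inf => // _ [j Dj <-].
  rewrite lerBlDr [leRHS]addrC.
  have [k Dk] := FD i j u v Di Dj; apply: le_trans.
  by apply: ge_inf => //; exists k.
rewrite mulrC -ler_pdivrMr//; apply: lb_le_inf => // _ [i Di <-].
rewrite ler_pdivrMr// mulrC; have [k Dk] := FZ a i u a0 Di; apply: le_trans.
by apply: ge_inf => //; exists k.
Qed.

(** Zorn's lemma for the reversed pointwise order. A chain below [p] is bounded below at [u] by
    [- p (- u)], so its pointwise infimum is finite and again sublinear. *)
Lemma sublinear_minimal p : sublinear p ->
  exists q, [/\ sublinear q, forall u, q u <= p u &
    forall r, sublinear r -> (forall u, r u <= q u) -> forall u, q u <= r u].
Proof.
move=> sp; pose T := {q : X -> R | sublinear q /\ forall u, q u <= p u}.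
pose le (q r : T) := `[< forall u, sval r u <= sval q u >].
pose pT : T := exist _ p (conj sp (fun u => lexx (p u))).
have [|q1 q2 q3 /asboolP le12 /asboolP le23||] := @ZL_preorder T pT le.
- by move=> q; apply/asboolP.
- by apply/asboolP => u; exact: le_trans (le23 u) (le12 u).
- move=> A Atot; have [[q0 Aq0]|A0] := pselect (A !=set0); last first.
    by exists pT => q Aq; exfalso; apply: A0; exists q.
  have lbA u : has_lbound [set sval q u | q in A].
    exists (- p (- u)) => _ [q Aq <-]; have [sq qp] := svalP q.
    by apply: le_trans (sublinear_ge u sq); rewrite lerN2.
  have sinf : sublinear (fun u => inf [set sval q u | q in A]).
    apply: sublinear_inf => //; first by exists q0.
      move=> q r u v Aq Ar.
      have [/asboolP qr|/asboolP rq] := Atot _ _ Aq Ar.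
      - exists r => //; apply: le_trans ((svalP r).1.1 u v) _.
        by rewrite lerD2r.
      - exists q => //; apply: le_trans ((svalP q).1.1 u v) _.
        by rewrite lerD2l.
    by move=> a q u a0 Aq; exists q => //; apply: (svalP q).1.2.
  have infp u : inf [set sval q u | q in A] <= p u.
    by apply: le_trans ((svalP q0).2 u); apply: ge_inf => //; exists q0.
  pose infA u := inf [set sval q u | q in A].
  exists (exist _ infA (conj sinf infp) : T) => q Aq; apply/asboolP => u /=.
  by apply: ge_inf => //; exists q.
move=> [q [sq qp]] qmin; exists q; split=> // r sr rq u.
have rp v : r v <= p v by exact: le_trans (rq v) (qp v).
have /asboolP := qmin (exist _ r (conj sr rp) : T) (asboolT rq).
exact.
Qed.

(** For sublinear [p], this is the largest sublinear functional below [p] whose value at [- x] is at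
    most [- p x]. *)
Definition sublinear_shift p x u :=
  inf [set p (u + t *: x) - t * p x | t in [set t | 0 <= t]].

Lemma sublinear_shift_has_lbound p x u : sublinear p ->
  has_lbound [set p (u + t *: x) - t * p x | t in [set t | 0 <= t]].
Proof.
move=> sp; exists (- p (- u)) => _ [t t0 <-].
have := sp.1 (u + t *: x) (- u); rewrite addrAC subrr add0r sublinearZ//; lra.
Qed.

Lemma sublinear_sublinear_shift p x :
  sublinear p -> sublinear (sublinear_shift p x).
Proof.
move=> sp; apply: (@sublinear_inf _ _ (fun t u => p (u + t *: x) - t * p x)).
- by exists 0 => /=.
- by move=> u; exact: sublinear_shift_has_lbound.
- move=> s t u v /= s0 t0; exists (s + t); first exact: addr_ge0.
  by have := sp.1 (u + s *: x) (v + t *: x); rewrite addrACA -scalerDl; lra.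
- move=> a t u a0 /= t0; exists (a * t); first exact/mulr_ge0/t0/ltW.
  by rewrite -scalerA -scalerDr mulrBr mulrA lerD2r; exact: sp.2.
Qed.

Lemma sublinear_shift_le p x u t : sublinear p -> 0 <= t ->
  sublinear_shift p x u <= p (u + t *: x) - t * p x.
Proof.
by move=> sp t0; apply: ge_inf; [exact: sublinear_shift_has_lbound|exists t].
Qed.

(* A minimal sublinear functional coincides with its shifts, which makes it
   superadditive. Shifting [p] itself along [x] first forces the value at
   [x]. *)
Theorem hahn_banach p x : sublinear p ->
  exists f : X -> R^o, [/\ linear f, forall u, f u <= p u & f x = p x].
Proof.
move=> sp; have spx := sublinear_sublinear_shift x sp.
have [q [sq qp qmin]] := sublinear_minimal spx.
have qD u v : q (u + v) = q u + q v.
  apply/eqP; rewrite eq_le sq.1/= -lerBrDr.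
  have := sublinear_shift_le v u sq ler01; rewrite scale1r mul1r.
  apply: le_trans; apply: qmin; first exact: sublinear_sublinear_shift.
  move=> w; have := sublinear_shift_le v w sq (lexx 0).
  by rewrite scale0r addr0 mul0r subr0.
have q0 := sublinear0 sq.
have qN u : q (- u) = - q u by apply/eqP; rewrite -addr_eq0 -qD addNr q0.
have qle u : q u <= p u.
  apply: le_trans (qp u) _; have := sublinear_shift_le x u sp (lexx 0).
  by rewrite scale0r addr0 mul0r subr0.
exists q; split=> //.
  move=> a u v; rewrite qD; congr (_ + _); have [a0|a0] := leP 0 a.
    exact: sublinearZ.
  rewrite -[a]opprK scaleNr qN sublinearZ ?oppr_ge0 1?ltW//.
  by rewrite /GRing.scale/= !mulNr.
(* Taking [t = 1] in the shift gives [q (- x) <= p 0 - p x = - p x]. *)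
apply/eqP; rewrite eq_le qle/= -lerN2 -qN (le_trans (qp _))//.
have := sublinear_shift_le x (- x) sp ler01.
by rewrite scale1r mul1r addNr sublinear0// add0r.
Qed.

End hahn_banach.

(** * Norming and separating functionals *)

Section dual_space.
Set Implicit Arguments.
Unset Strict Implicit.
Unset Printing Implicit Defensive.
Context {R : realType} {Z : normedModType R}.

Lemma dual_of_bounded (f : Z -> R^o) (M : R) : linear f ->
  (forall v, `|f v| <= M * `|v|) -> exists F : dual Z, F =1 f.
Proof.
move=> fl fM.
pose fL := GRing.isLinear.Build R Z R^o *:%R f fl.
pose g : {linear Z -> R^o} := HB.pack f fL.
suff gc : continuous g.
  have fP : f \in @continuous_linear R Z by rewrite inE; split.
  by exists (Dual fP).
apply/linear_bounded_continuous/linear_boundedP.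
near=> r => v; apply: le_trans (fM v) _.
by apply: ler_wpM2r => //; near: r; exact: nbhs_pinfty_ge.
Unshelve. all: by end_near. Qed.

Lemma le_dual_norm (f : dual Z) v : `|f v| <= `|f| * `|v|.
Proof. exact: le_opnorm. Qed.

Lemma dual_norm_le (f : dual Z) (c : R) : 0 <= c ->
  (forall v, `|f v| <= c * `|v|) -> `|f| <= c.
Proof.
move=> c0 fc; apply: opnorm_lub => v v1; apply: le_trans (fc v) _.
by rewrite ler_piMr.
Qed.

(** Otherwise half the norm would bound [f] on the unit ball, forcing [f = 0], for which [v = 0]
    works. *)
Lemma dual_norm_almost_attained (f : dual Z) :
  exists v : Z, `|v| <= 1 /\ `|f| <= 2 * `|f v|.
Proof.
apply: contrapT => nv; have f0 : `|f| <= `|f| / 2.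
  apply: opnorm_lub => v v1; rewrite leNgt; apply/negP => vf.
  apply: nv; exists v; split=> //.
  by move: vf; rewrite ltr_pdivrMr// mulrC => /ltW.
by apply: nv; exists 0; rewrite normr0 linear0 normr0; split=> //; lra.
Qed.

(** Hahn-Banach applied at [v] to the distance to [D], which is sublinear, vanishes on [D] and is
    dominated by the norm. *)
Lemma dual_separation (D : set Z) (v : Z) (d : R) :
  D 0 -> (forall s t, D s -> D t -> D (s + t)) ->
  (forall a s, D s -> D (a *: s)) ->
  (forall s, D s -> d <= `|v - s|) ->
  exists F : dual Z, [/\ forall u, `|F u| <= `|u|,
    forall s, D s -> F s = 0 & d <= F v].
Proof.
move=> D0 DD DZ Dv; pose p u := inf [set `|u - s| | s in D].
have lb u : has_lbound [set `|u - s| | s in D] by exists 0 => _ [s _ <-].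
have sp : sublinear p.
  apply: (@sublinear_inf _ _ _ _ (fun s u => `|u - s|)) => //.
  - by exists 0.
  - move=> s t u w Ds Dt; exists (s + t); first exact: DD.
    by rewrite opprD addrACA ler_normD.
  - move=> a s u a0 Ds; exists (a *: s); first exact: DZ.
    by rewrite -scalerBr normrZ gtr0_norm.
have ple u s : D s -> p u <= `|u - s|.
  by move=> Ds; apply: ge_inf => //; exists s.
have [f [fl fp fv]] := hahn_banach v sp.
have fN u : f (- u) = - f u.
  pose fL := GRing.isLinear.Build R Z R^o *:%R f fl.
  exact: (linearN (HB.pack f fL : {linear Z -> R^o})).
have fle u : `|f u| <= 1 * `|u|.
  have le w : f w <= `|w|.
    by rewrite -[in leRHS](subr0 w) (le_trans (fp w))// ple.
  by rewrite mul1r ler_norml le andbT lerNl -fN (le_trans (le _))// normrN.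
have [F Ff] := dual_of_bounded fl fle.
exists F; split.
- by move=> u; rewrite Ff -[leRHS]mul1r.
- have le0 s : D s -> f s <= 0.
    by move=> Ds; rewrite (le_trans (fp s))// -(normr0 Z) -(subrr s) ple.
  move=> s Ds; apply/eqP; rewrite Ff eq_le le0//= -lerN2 oppr0 -fN le0//.
  by rewrite -scaleN1r; exact: DZ.
- rewrite Ff fv; apply: lb_le_inf; first by exists `|v - 0|, 0.
  by move=> _ [s Ds <-]; exact: Dv.
Qed.

Lemma norming_functionals_neq0 (v : Z) : v != 0 -> norming_functionals v !=set0.
Proof.
move=> v0.
have [||||F [F1 _ Fv]] := @dual_separation [set 0] v `|v| => //.
- by move=> s t -> ->; rewrite addr0.
- by move=> a s ->; rewrite scaler0.
- by move=> s ->; rewrite subr0.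
have {}Fv : F v = `|v|.
  by apply/eqP; rewrite eq_le Fv (le_trans (ler_norm _) (F1 v)).
exists F; split=> //; apply/eqP; rewrite eq_le dual_norm_le//=; last first.
  by move=> u; rewrite mul1r.
rewrite -(ler_pM2r (_ : 0 < `|v|)) ?normr_gt0// mul1r -{1}Fv.
exact: le_trans (ler_norm _) (le_dual_norm _ _).
Qed.

End dual_space.

(** * Weak compactness through ultrafilters *)

Section ultrafilter_limits.
Set Implicit Arguments.
Unset Strict Implicit.
Unset Printing Implicit Defensive.

Lemma ultra_fmap (T S : Type) (u : T -> S) (V : set_system T) :
  UltraFilter V -> UltraFilter (u @ V).
Proof.
move=> UV; split; first exact: fmap_proper_filter.
move=> G GP VG; apply/seteqP; split=> A GA; last exact: VG.
have [//|VnA] := in_ultra_setVsetC (u @^-1` A) UV.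
have : G (A `&` ~` A) by apply: filterI => //; exact: VG.
by rewrite setICr => /filter_not_empty.
Qed.

Lemma ultra_bounded_cvg (R : realType) (T : Type) (V : set_system T)
    (u : T -> R) (M : R) :
  UltraFilter V -> (forall t, `|u t| <= M) -> exists l : R, u @ V --> l.
Proof.
move=> UV uM; have uVM : V (u @^-1` `[- M, M]%classic).
  by apply: filterE => t; rewrite /= in_itv/= -ler_norml; exact: uM.
have := @segment_compact R (- M) M; rewrite compact_ultra => cM.
by have [l [_ ul]] := cM _ (ultra_fmap u UV) uVM; exists l.
Qed.

(** If the preimage of a neighbourhood of [l] is not in [F], then [F] restricted to its complement
    is proper and extends to an ultrafilter violating the hypothesis. *)
Lemma cvg_from_ultra (T : Type) (S : topologicalType) (F : set_system T)
    (u : T -> S) (l : S) : ProperFilter F ->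
  (forall W, UltraFilter W -> F `<=` W -> u @ W --> l) -> u @ F --> l.
Proof.
move=> FF Wl A lA; apply: contrapT => nFA.
have PG : ProperFilter (within (~` (u @^-1` A)) F).
  split; last exact: within_filter.
  move=> F0; apply: nFA; suff : F (u @^-1` A) by [].
  by apply: (@filterS _ F _ _ _ _ F0) => t nA; apply: contrapT.
have [W [UW GW]] := ultraFilterLemma PG.
have WA : W (u @^-1` A).
  apply: (Wl W UW _ A lA) => B FB; apply: GW.
  exact: (@filterS _ F _ _ _ _ FB).
have WnA : W (~` (u @^-1` A)) by apply: GW; exact: (@filterE _ F).
have : W (u @^-1` A `&` ~` (u @^-1` A)) by exact: filterI.
by rewrite setICr => /filter_not_empty.
Qed.

(** Banach-Alaoglu: bounded scalars converge along an ultrafilter, and linearity and the norm bound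
    pass to the pointwise limit. *)
Lemma ultra_dual_cvg (R : realType) (Z : normedModType R) (T : Type)
    (V : set_system T) (F : T -> dual Z) :
  UltraFilter V -> (forall t, `|F t| <= 1) ->
  exists f : dual Z, `|f| <= 1 /\ forall v, F t v @[t --> V] --> f v.
Proof.
move=> UV F1.
have Fb v t : `|F t v| <= `|v|.
  by rewrite (le_trans (le_dual_norm _ _))// ler_piMl.
have /choice[l Fl] v : exists l : R, F t v @[t --> V] --> l.
  exact: ultra_bounded_cvg (Fb v).
have ll : linear (l : Z -> R^o).
  move=> a u v.
  have : (a * F t u + F t v) @[t --> V] --> a * l u + l v.
    by apply: cvgD => //; exact: cvgMl_tmp.
  rewrite (_ : (fun t => _) = (fun t => F t (a *: u + v))).
    exact/cvg_unique/Fl.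
  by apply/funext => t; rewrite linearP.
have lb v : `|l v| <= 1 * `|v|.
  rewrite mul1r; apply: (cvgr_to_le (cvg_norm (Fl v))).
  by apply: nearW => t; exact: Fb.
have [f fl] := dual_of_bounded ll lb.
exists f; split=> [|v]; last by rewrite fl.
by apply: dual_norm_le => // v; rewrite fl.
Qed.

Lemma dual_eval (R : realType) (Z : normedModType R) (z : Z) :
  exists G : dual (dual Z), forall f, G f = f z.
Proof.
have ev : linear (fun f : dual Z => f z : R^o) by [].
have evb (f : dual Z) : `|f z| <= `|z| * `|f|.
  by rewrite mulrC; exact: le_dual_norm.
by have [G GE] := dual_of_bounded ev evb; exists G.
Qed.

(** The evaluations at the [y t] have a pointwise limit in the bidual, and reflexivity represents it
    by a point. *)
Lemma ultra_reflexive_cvg (R : realType) (X : normedModType R) (T : Type)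
    (V : set_system T) (y : T -> X) :
  reflexive_space X -> UltraFilter V -> (forall t, `|y t| <= 1) ->
  exists v : X, forall f : dual X, f (y t) @[t --> V] --> f v.
Proof.
move=> rX UV y1; have /choice[G GE] t := dual_eval (y t).
have G1 t : `|G t| <= 1.
  apply: dual_norm_le => // f; rewrite GE mul1r.
  by rewrite (le_trans (le_dual_norm _ _))// ler_piMr.
have [phi [_ Gphi]] := ultra_dual_cvg UV G1; have [v phiv] := rX phi.
exists v => f; rewrite -phiv.
rewrite (_ : (fun t => _) = (fun t => G t f)); first exact: Gphi.
by apply/funext => t; rewrite GE.
Qed.

End ultrafilter_limits.

(** * Weakly convergent sequences in the dual of a reflexive space *)

Section weak_sequences.
Set Implicit Arguments.
Unset Strict Implicit.
Unset Printing Implicit Defensive.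

(* Association lists as formal linear combinations: concatenation is addition,
   and those with rational coefficients form a countType. *)
Definition lincomb (R : pzRingType) (Z : lmodType R) (f_ : nat -> Z)
  (s : seq (nat * R)) := \sum_(p <- s) p.2 *: f_ p.1.

Definition rat_lincomb (R : unitRingType) (Z : lmodType R) (f_ : nat -> Z)
  (q : seq (nat * rat)) := lincomb f_ [seq (p.1, ratr p.2) | p <- q].

Lemma lincomb_rat_approx (R : realType) (Z : normedModType R) (f_ : nat -> Z) :
  (forall n, `|f_ n| <= 1) -> forall s (e : R), 0 < e ->
  exists q, `|lincomb f_ s - rat_lincomb f_ q| < e.
Proof.
move=> f1; elim=> [|[n a] s IH] e e0.
  by exists [::]; rewrite /rat_lincomb /lincomb !big_nil subrr normr0.
have e20 : 0 < e / 2 by rewrite divr_gt0.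
have [q qs] := IH (e / 2) e20.
have [|r] := @rat_in_itvoo R (a - e / 2) (a + e / 2); first by lra.
rewrite in_itv/= => /andP[ra ar].
exists ((n, r) :: q); rewrite /rat_lincomb /lincomb /= !big_cons/=.
rewrite opprD addrACA -scalerBl (splitr e).
rewrite (le_lt_trans (ler_normD _ _))// ltrD// normrZ.
rewrite (le_lt_trans (_ : _ <= `|a - ratr r|)) ?ler_piMr//.
by rewrite ltr_norml; lra.
Qed.

(* By the bipolar theorem in the reflexive space [dual X], a functional
   vanishing on the annihilator of the [f_ n] lies in their closed span. *)
Lemma dual_rat_lincomb_dense (R : realType) (X : normedModType R)
    (f_ : nat -> dual X) (phi : dual X) :
  reflexive_space X -> (forall n, `|f_ n| <= 1) ->
  (forall w, (forall n, f_ n w = 0) -> phi w = 0) ->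
  forall e : R, 0 < e -> exists q, `|phi - rat_lincomb f_ q| < e.
Proof.
move=> rX f1 phi0 e e0; apply: contrapT => nq.
have far s : range (lincomb f_) s -> e / 2 <= `|phi - s|.
  move=> [l _ <-]; rewrite leNgt; apply/negP => phil.
  have [q ql] := lincomb_rat_approx f1 l (divr_gt0 e0 (ltr0n _ 2)).
  apply: nq; exists q; rewrite -(subrKA (lincomb f_ l)) (splitr e).
  by rewrite (le_lt_trans (ler_normD _ _))// ltrD.
have [|||F [_ F0 Fphi]] := dual_separation _ _ _ far.
- by exists [::] => //; rewrite /lincomb big_nil.
- move=> _ _ [l _ <-] [l' _ <-]; exists (l ++ l') => //.
  by rewrite /lincomb big_cat.
- move=> a _ [l _ <-]; exists [seq (p.1, a * p.2) | p <- l] => //.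
  rewrite /lincomb big_map scaler_sumr; apply: eq_bigr => p _ /=.
  by rewrite scalerA.
have [w Fw] := rX F.
have : phi w = 0.
  apply: phi0 => n; rewrite -Fw; apply: F0; exists [:: (n, 1)] => //.
  by rewrite /lincomb big_seq1 scale1r.
by move: Fphi; rewrite Fw => + phiw; rewrite phiw; lra.
Qed.

Lemma filter_forall_lt (T : Type) (F : set_system T) (P : nat -> set T)
    (m : nat) :
  Filter F -> (forall k, F (P k)) -> F [set t | forall k, (k < m)%N -> P k t].
Proof.
move=> FF FP; elim: m => [|m IH]; first exact: filterE.
apply: (@filterS _ F _ _ _ _ (filterI IH (FP m))) => t [Pt Pm] k.
by rewrite ltnS leq_eqVlt => /predU1P[->|/Pt].
Qed.

(* Whitley's argument: the sequence is chosen to converge on countably many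
   points [z k] that norm the closed span of the [f_ n]. Every pointwise
   ultralimit [h] agrees with [f] at these points, and [h - f] lies in that
   span, so [h = f]. *)
Lemma weak_cluster_point_weak_cvg (R : realType) (X : normedModType R)
    (U : set_system nat) (f_ : nat -> dual X) (f : dual X) :
  reflexive_space X -> ProperFilter U -> (forall n, `|f_ n| <= 1) ->
  (forall v, f_ n v @[n --> U] --> f v) ->
  exists n_ : nat -> nat, weak_cvg (f_ \o n_) f.
Proof.
move=> rX PU f1 Uf.
have /choice[x_ x_P] q := dual_norm_almost_attained (rat_lincomb f_ q).
(* Codes of no list default to the empty list; this only repeats a point of the family [x_]. *)
pose z k := x_ (odflt [::] (unpickle k)).
have /choice[n_ n_P] j : exists n, forall k, (k < j.+1)%N ->
    `|f (z k) - f_ n (z k)| < j.+1%:R^-1.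
  apply: (@filter_ex _ U); apply: filter_forall_lt => k.
  by move/cvgrPdist_lt : (Uf (z k)); apply; rewrite invr_gt0.
have fz k : f_ (n_ j) (z k) @[j --> \oo] --> f (z k).
  apply/cvgrPdist_lt => e e0.
  have := @near_infty_natSinv_lt R (PosNum e0); apply: filter_app.
  near=> j => je; apply: lt_trans je; apply: n_P; rewrite ltnS.
  by near: j; exact: nbhs_infty_ge.
exists n_ => G; have [v Gv] := rX G; rewrite Gv.
rewrite (_ : (fun n => _) = (fun j => f_ (n_ j) v)); last by apply/funext.
apply: cvg_from_ultra => W UW Woo.
have [h [_ Wh]] := ultra_dual_cvg UW (fun j => f1 (n_ j)).
suff <- : h = f by exact: Wh.
have hz k : h (z k) = f (z k).
  have Wfz : f_ (n_ j) (z k) @[j --> W] --> f (z k).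
    by move=> A Al; exact: (Woo _ (fz k A Al)).
  by move: Wfz; apply: cvg_unique (Wh (z k)).
apply/eqP; rewrite -subr_eq0 -normr_le0; apply/ler_addgt0Pr => e e0.
(* With [g] within [e / 4] of [h - f], and [h - f] zero at [x_ q], the norm of [g] is at most
   [2 * |g (x_ q)| <= 2 * |h - f - g|]. Hence [|h - f| <= 3 * |h - f - g| < e]. *)
rewrite add0r; have e40 : 0 < e / 4 by rewrite divr_gt0.
have [|q hfq] := @dual_rat_lincomb_dense _ _ f_ (h - f) rX f1 _ _ e40.
  (* Both [h] and [f] are pointwise limits of terms of [f_], so they vanish wherever all the [f_ n]
     do. *)
  move=> w fw0; have lim0 T (V : set_system T) (u : T -> nat) (g : dual X) :
      ProperFilter V -> f_ (u t) w @[t --> V] --> g w -> g w = 0.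
    move=> PV; rewrite (_ : (fun t => _) = (fun=> 0)); last first.
      by apply/funext => t; rewrite fw0.
    by move=> Vg; exact: (cvg_unique (@norm_hausdorff R R^o) Vg (cvg_cst _)).
  have -> : (h - f) w = h w - f w by [].
  by rewrite (lim0 _ _ _ _ _ (Wh w)) (lim0 _ _ id _ _ (Uf w)) subrr.
have [xq1 gq] := x_P q; set g := rat_lincomb f_ q in hfq gq.
have hfx : (h - f) (x_ q) = 0.
  have := hz (pickle q); rewrite /z pickleK /= => hfx.
  by rewrite -[LHS]/(h (x_ q) - f (x_ q)) hfx subrr.
have gx : `|g (x_ q)| <= `|h - f - g|.
  have -> : g (x_ q) = - (h - f - g) (x_ q).
    have -> : (h - f - g) (x_ q) = (h - f) (x_ q) - g (x_ q) by [].
    by rewrite hfx sub0r opprK.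
  by rewrite normrN (le_trans (le_dual_norm _ _))// ler_piMr.
rewrite -(subrK g (h - f)) (le_trans (ler_normD _ _))//; lra.
Unshelve. all: by end_near. Qed.

End weak_sequences.

(** * Approximate orthogonality and norming functionals *)

Section coapproximation.
Set Implicit Arguments.
Unset Strict Implicit.
Unset Printing Implicit Defensive.

(** Evaluating [f] at [y + l *: x] gives the unsquared inequality
    [|y| - eps * |l *: x| <= |y + l *: x|]. *)
Lemma approx_orthogonal_norming (R : realType) (X : normedModType R)
    (eps : R) (x y : X) (f : dual X) : 0 <= eps -> norming_functionals y f ->
  `|f x| <= eps * `|x| -> approx_orthogonal eps y x.
Proof.
move=> eps0 [f1 fy] fx l; set N := `|y|; set L := `|l *: x|.
have N0 : 0 <= N by exact: normr_ge0.
have nN : N - eps * L <= `|y + l *: x|.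
  have := le_dual_norm f (y + l *: x); rewrite f1 mul1r; apply: le_trans.
  have -> : f (y + l *: x) = N + l * f x by rewrite linearD linearZ/= fy.
  rewrite (le_trans _ (ler_norm _))// lerD2l.
  rewrite lerNl (le_trans (ler_norm _))// normrN normrM /L normrZ mulrCA.
  exact: ler_wpM2l.
(* Squaring needs a nonnegative left side; if it is negative, then [N ^+ 2 - 2 * eps * N * L <= 0]
   already. *)
have [le0|lt0] := leP 0 (N - eps * L).
  apply: le_trans (_ : (N - eps * L) ^+ 2 <= _); first by nra.
  by rewrite ler_pXn2r ?nnegrE.
by apply: le_trans (sqr_ge0 _); nra.
Qed.

Lemma not_approx_orthogonal_norming (R : realType) (X : normedModType R)
    (Y : submodClosed X) (eps : R) (x y : X) :
  0 <= eps -> y \in Y -> ~ approx_orthogonal eps y x ->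
  exists (z : X) (f : dual X), [/\ z \in Y, `|z| = 1, `|f| = 1, f z = 1 &
    eps * `|x| < f x].
Proof.
move=> eps0 yY nyx.
have y0 : y != 0.
  apply/eqP => y0; apply: nyx => l.
  rewrite y0 normr0 expr0n/= mulr0 mul0r subr0; exact: sqr_ge0.
have [f [f1 fy]] := norming_functionals_neq0 y0.
have fx : eps * `|x| < `|f x|.
  rewrite ltNge; apply/negP => fx; apply: nyx.
  exact: approx_orthogonal_norming fx.
have fx0 : f x != 0.
  by rewrite -normr_gt0; apply: le_lt_trans fx; exact: mulr_ge0.
have sg1 : `|Num.sg (f x)| = 1 by rewrite normr_sg fx0.
(* Multiplying both [y] and [f] by the sign of [f x] makes the value at [x] positive and keeps [f]
   norming. *)
exists ((Num.sg (f x) / `|y|) *: y), (Num.sg (f x) *: f); split.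
- exact: rpredZ.
- by rewrite normrZ normrM sg1 mul1r normfV normr_id mulVf// normr_eq0.
- by rewrite normrZ sg1 f1 mulr1.
- rewrite dualZ linearZ/= fy /GRing.scale/= mulfVK ?normr_eq0//.
  by rewrite -expr2 sqr_sg fx0.
- by rewrite dualZ -normrEsg.
Qed.

(** A limit outside [Y] would be separated from [Y] by a functional vanishing on every [y_ t]. *)
Lemma weak_limit_closed_submod (R : realType) (X : normedModType R)
    (Y : submodClosed X) (T : Type) (V : set_system T) (y_ : T -> X) (y : X) :
  closed [set x : X | x \in Y] -> ProperFilter V -> (forall t, y_ t \in Y) ->
  (forall f : dual X, f (y_ t) @[t --> V] --> f y) -> y \in Y.
Proof.
move=> cY PV yY Vy; apply: contrapT => nYy.
have /nbhs_ballP[d /= d0 dY] : nbhs y (~` [set x : X | x \in Y]).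
  by apply: open_nbhs_nbhs; split=> //; exact: closed_openC.
have [|||s Ys|F [_ F0 Fy]] := @dual_separation _ _ [set x : X | x \in Y] y d.
- exact: rpred0.
- by move=> s t; exact: rpredD.
- by move=> a s; exact: rpredZ.
- by rewrite leNgt; apply/negP => ys; apply: (dY s) => //; rewrite -ball_normE.
have := Vy F; rewrite (_ : (fun t => _) = (fun=> 0)); last first.
  by apply/funext => t; rewrite F0//; exact: yY.
move=> VF; have F0y : F y = 0.
  exact: (cvg_unique (@norm_hausdorff R R^o) VF (cvg_cst _)).
by move: Fy; rewrite F0y leNgt d0.
Qed.

End coapproximation.

(** * Norming functionals shared with an anti-coproximinal subspace *)

Theorem theorem2p14 (R : realType) (X : completeNormedModType R)
    (Y : submodClosed X) :
  reflexive_space X ->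
  kadets_klee (dual X) ->
  (exists x : X, x \notin Y) ->
  closed [set x : X | x \in Y] ->
  dim_gt 1 Y ->
  strongly_anti_coproximinal Y ->
  forall x : X, x != 0 ->
    exists y : X, [/\ y \in Y, y != 0 &
      norming_functionals y `&` norming_functionals x !=set0].
Proof.
move=> rX kkX _ cY _ antiY x x0.
have [xY|xNY] := boolP (x \in Y).
  exists x; split=> //; rewrite setIid.
  exact: norming_functionals_neq0.
have nx0 : 0 < `|x| by rewrite normr_gt0.
have bad n : exists p : X * dual X, [/\ p.1 \in Y, `|p.1| = 1, `|p.2| = 1,
    p.2 p.1 = 1 & (1 - n.+1%:R^-1) * `|x| < p.2 x].
  have n1 : 0 < n.+1%:R^-1 :> R by rewrite invr_gt0.
  have n2 : n.+1%:R^-1 <= 1 :> R by rewrite invf_le1// ler1n.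
  have eps01 : 0 <= (1 - n.+1%:R^-1 : R) < 1.
    by rewrite subr_ge0 n2 ltrBlDr ltrDl.
  have eps0 := proj1 (andP eps01).
  apply: contrapT => np; apply: (antiY x xNY _ eps01); exists 0; split.
    exact: rpred0.
  move=> y yY; rewrite subr0; apply: contrapT => nyx; apply: np.
  have [z [f zf]] := not_approx_orthogonal_norming eps0 yY nyx.
  by exists (z, f).
have {bad}/choice[p pP] := bad.
pose y_ n := (p n).1; pose f_ n := (p n).2.
have y1 n : `|y_ n| = 1 by have [] := pP n.
have f1 n : `|f_ n| = 1 by have [] := pP n.
have yY n : y_ n \in Y by have [] := pP n.
have fy n : f_ n (y_ n) = 1 by have [] := pP n.
have fx n : (1 - n.+1%:R^-1) * `|x| < f_ n x by have [] := pP n.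
have y1' n : `|y_ n| <= 1 by rewrite y1.
have f1' n : `|f_ n| <= 1 by rewrite f1.
have [U [UU Uoo]] := @ultraFilterLemma _ (\oo) _.
have [f [fle1 Uf]] := ultra_dual_cvg UU f1'.
have fxE : f x = `|x|.
  apply/eqP; rewrite eq_le; apply/andP; split.
    rewrite (le_trans (ler_norm _))// (le_trans (le_dual_norm _ _))//.
    by rewrite ler_piMl.
  (* The lower bounds on [f_ n x] tend to the norm of [x], so the limit [f x] is at least that
     norm. *)
  have cx : (fun n => (1 - n.+1%:R^-1) * `|x|) @ U --> `|x|.
    have : (fun n => (1 - n.+1%:R^-1) * `|x|) @ \oo --> (1 - 0) * `|x|.
      apply: cvgMr_tmp; apply: cvgB; first exact: cvg_cst.
      exact: cvg_harmonic.
    by rewrite subr0 mul1r => cx A Ax; exact: (Uoo _ (cx A Ax)).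
  apply: (ler_cvg_to cx (Uf x)).
  by apply: (@filterE _ U) => n; exact/ltW.
have fE : `|f| = 1.
  apply/eqP; rewrite eq_le fle1/= -(ler_pM2r nx0) mul1r -{1}fxE.
  exact: le_trans (ler_norm _) (le_dual_norm _ _).
have [n_ n_f] := weak_cluster_point_weak_cvg rX _ f1' Uf.
have f_cvg : f_ \o n_ @ \oo --> f.
  apply: kkX => //; rewrite fE (_ : (fun n => _) = (fun=> 1)).
    exact: cvg_cst.
  by apply/funext => n; exact: f1.
(* The ultrafilter [U] is reused here on the positions [j] of the subsequence; only its refining
   [\oo] matters. *)
have [y yw] := ultra_reflexive_cvg rX UU (fun j => y1' (n_ j)).
have fyE : f y = 1.
  (* Since [f_ (n_ j)] equals 1 at the unit vector [y_ (n_ j)], the error is at most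
     [|f - f_ (n_ j)|]. *)
  have : (f (y_ (n_ j)) @[j --> \oo] --> (1 : R)).
    apply/cvgrPdist_lt => e e0.
    move/cvgrPdist_lt : f_cvg => /(_ _ e0); apply: filterS => j.
    apply: le_lt_trans; rewrite -(fy (n_ j)) distrC.
    have := le_dual_norm (f - f_ (n_ j)) (y_ (n_ j)).
    by rewrite y1 mulr1.
  move=> oof1; have Uf1 : f (y_ (n_ j)) @[j --> U] --> (1 : R).
    by move=> A A1; exact: (Uoo _ (oof1 A A1)).
  exact: (cvg_unique (@norm_hausdorff R R^o) (yw f) Uf1).
have y0 : y != 0.
  apply/eqP => y0; move: fyE; rewrite y0 linear0 => /eqP.
  by rewrite eq_sym oner_eq0.
(* Weak lower semicontinuity of the norm, tested on a norming functional of [y]. *)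
have yle1 : `|y| <= 1.
  have [g [g1 gy]] := norming_functionals_neq0 y0.
  rewrite -gy; apply: (cvgr_to_le (yw g)).
  apply: (@filterE _ U) => j /=; rewrite (le_trans (ler_norm _))//.
  by rewrite (le_trans (le_dual_norm _ _))// g1 y1 mulr1.
have yE : `|y| = 1.
  apply/eqP; rewrite eq_le yle1/= -fyE (le_trans (ler_norm _))//.
  by rewrite (le_trans (le_dual_norm _ _))// fE mul1r.
exists y; split=> //.
  exact: (weak_limit_closed_submod cY _ (fun j => yY (n_ j)) yw).
by exists f; split; split=> //; rewrite fyE yE.
Qed.
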